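(* Suppose that $\int\phi(\|x\|)\,P(dx)<\infty$ and that $m_j(P)>m_k(P)$ for $j=1,2,\dots,k-1$. Then $\Theta'\neq\emptyset$, i.e. there exists $(F,A)\in\Xi_k$ with $\Phi(F,A,P)=m_k(P)$.
   Context: Let $p,q,k$ be positive integers with $q\le p$, and let $P$ be a probability measure on $\mathbb R^p$. $\|\cdot\|$ is the Euclidean norm. $\phi:\mathbb R\to\mathbb R$ is a non-negative, nondecreasing, continuous function with $\phi(0)=0$, and there is $\lambda>0$ with $\phi(2r)\le\lambda\phi(r)$ for all $r>0$. $\mathcal O(p\times q)$ is the set of real $p\times q$ matrices $A$ with $A^TA=I_q$. For $j\ge1$, $\mathcal R_j$ is the set of nonempty subsets of $\mathbb R^q$ with at most $j$ elements, and $\Xi_j=\mathcal R_j\times\mathcal O(p\times q)$. For a nonempty finite set $F\subset\mathbb R^q$ and $A\in\mathcal O(p\times q)$, $$\Phi(F,A,P)=\int\min_{f\in F}\phi(\|x-Af\|)\,P(dx),\qquad m_j(P)=\inf_{(F,A)\in\Xi_j}\Phi(F,A,P),$$ and $\Theta'=\{(F,A)\in\Xi_k:\Phi(F,A,P)=m_k(P)\}$. *)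

(* Defs.v *)
From mathcomp Require Import all_boot all_order all_algebra finmap.
From mathcomp Require Import all_classical all_reals all_analysis.

Set Implicit Arguments.
Unset Strict Implicit.
Unset Printing Implicit Defensive.

Import Order.TTheory GRing.Theory Num.Theory.
Import numFieldNormedType.Exports.

Local Open Scope classical_set_scope.
Local Open Scope ring_scope.

(* The library's norm on matrices is the sup norm, hence a separate Euclidean
   norm. *)
Definition enorm (R : realType) (n : nat) (x : 'cV[R]_n) : R :=
  Num.sqrt (\sum_(i < n) x i ord0 ^+ 2).

(* R^n with its Borel sigma-algebra; the library's topology on matrices is the
   entrywise one, that is the usual topology of R^n. *)
Notation borel_cV R n := (g_sigma_algebraType (@open 'cV[R]_n)).

Definition orthonormal_frames (R : realType) (p q : nat) : set 'M[R]_(p, q) :=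
  [set A | A^T *m A = 1%:M].

Definition center_sets (R : realType) (q j : nat) : set {fset 'cV[R]_q} :=
  [set F | (0 < #|` F| <= j)%N].

Arguments orthonormal_frames : clear implicits.
Arguments center_sets : clear implicits.

Definition Xi (R : realType) (p q j : nat) :
    set ({fset 'cV[R]_q} * 'M[R]_(p, q)) :=
  center_sets R q j `*` orthonormal_frames R p q.

Arguments Xi : clear implicits.

(* +oo is the neutral element of mine, so for nonempty F the integrand is the
   minimum over F of the real numbers phi (enorm (x - A *m f)). *)
Definition Phi (R : realType) (p q : nat) (phi : R -> R)
    (F : {fset 'cV[R]_q}) (A : 'M[R]_(p, q))
    (P : probability (borel_cV R p) R) : \bar R :=
  (\int[P]_x \big[mine/+oo]_(f <- F)
     (phi (enorm ((x : 'cV[R]_p) - A *m f)))%:E)%E.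

Definition optimal_value (R : realType) (p q : nat) (phi : R -> R) (j : nat)
    (P : probability (borel_cV R p) R) : \bar R :=
  ereal_inf [set Phi phi FA.1 FA.2 P | FA in Xi R p q j].

Arguments optimal_value {R p} q phi j P.

Definition Theta' (R : realType) (p q : nat) (phi : R -> R) (k : nat)
    (P : probability (borel_cV R p) R) :
    set ({fset 'cV[R]_q} * 'M[R]_(p, q)) :=
  [set FA | Xi R p q k FA /\ Phi phi FA.1 FA.2 P = optimal_value q phi k P].

Arguments Theta' {R p} q phi k P.

(* Main.v *)
(* Take a minimising sequence (F_n, A_n), enumerate F_n = {f_1, ..., f_k}, and
   compactify R^q by f |-> (t, t f) with t = 1 / (1 + |f|).  Along a subsequence
   every t, every t f and A_n converge, to tau_i, g_i and B.  For each x the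
   lower limit of phi |x - A_n f_i| is at least phi |x - B (g_i / tau_i)|: if
   tau_i = 0 the distances diverge, so phi being nondecreasing any centre will
   do, in particular the value 0 that division by zero assigns to g_i / tau_i.
   By Fatou's lemma the set of the g_i / tau_i together with B is optimal. *)
Require Import Defs.
From mathcomp Require Import all_boot all_order all_algebra finmap.
From mathcomp Require Import all_classical all_reals all_analysis.
From mathcomp Require Import measurable_realfun.

Set Implicit Arguments.
Unset Strict Implicit.
Unset Printing Implicit Defensive.

Import Order.TTheory GRing.Theory Num.Theory.
Import numFieldNormedType.Exports.

Local Open Scope classical_set_scope.
Local Open Scope ring_scope.

(** * Subsequences and lower limits *)

Lemma increasing_seq_cvgnoo (s : nat -> nat) :
  increasing_seq s -> s @ \oo --> \oo.
Proof.
move=> s_incr; have s_ge n : (n <= s n)%N.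
  elim: n => // n IHn; apply: leq_ltn_trans IHn _.
  exact: ((increasing_seqP s).2 s_incr n).
move=> A [N _ NA]; exists N => // n Nn.
by apply: NA; exact: leq_trans Nn (s_ge n).
Qed.

(** Bolzano-Weierstrass is applied to one index after another. Each extraction refines the previous
    subsequence, so the convergence already obtained survives. *)
Lemma bounded_family_subseq (R : realType) (I : finType) (M : R)
    (u : I -> nat -> R) : (forall i n, `|u i n| <= M) ->
  exists2 s : nat -> nat, increasing_seq s & forall i, cvgn (u i \o s).
Proof.
move=> uM; suff [s s_incr cvg_s] : exists2 s : nat -> nat, increasing_seq s &
    forall i, i \in enum I -> cvgn (u i \o s).
  by exists s => // i; apply: cvg_s; rewrite mem_enum.
elim: (enum I) => [|i r [s s_incr cvg_s]]; first by exists id.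
have [|s' s'_incr cvg_s'] := @bolzano_weierstrass R (u i \o s).
  exists M; split; first exact: num_real.
  by move=> N MN n _; exact: le_trans (uM _ _) (ltW MN).
exists (s \o s') => [m n|j]; first exact: etrans (s_incr _ _) (s'_incr _ _).
rewrite inE => /predU1P[->//|/cvg_s /cvg_ex[l us_l]].
apply/cvg_ex; exists l.
exact: (cvg_comp s' (u j \o s) (increasing_seq_cvgnoo s'_incr) us_l).
Qed.

(** Some tail has infimum at least [a - e], and the lower limit is the supremum of the tail infima.
    The slack [e] is the one that continuity of [phi] leaves in [distance_limit]. *)
Lemma le_limn_einf (R : realType) (a : \bar R) (u : nat -> \bar R) :
  (forall e : R, 0 < e -> \forall n \near \oo, (a <= u n + e%:E)%E) ->
  (a <= limn_einf u)%E.
Proof.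
move=> a_le; apply/lee_addgt0Pr => e /a_le[N _ NP].
rewrite -leeBlDr// limn_einf_lim (cvg_lim _ (@cvg_einfs_sup _ u))//.
apply: le_trans (ereal_sup_ubound _); last by exists N.
apply: le_ereal_inf_tmp => _ [n /= Nn <-].
by rewrite EFinN leeBlDr//; exact: NP.
Qed.

(** * Euclidean norm and orthonormal frames *)

Section euclidean_norm.
Variables (R : realType).
Implicit Types n p q : nat.

Lemma enorm_ge0 n (x : 'cV[R]_n) : 0 <= enorm x.
Proof. exact: sqrtr_ge0. Qed.

Lemma sqr_enorm n (x : 'cV[R]_n) : enorm x ^+ 2 = (x^T *m x) ord0 ord0.
Proof.
rewrite sqr_sqrtr ?sumr_ge0// => [|i _]; last exact: sqr_ge0.
by rewrite mxE; apply: eq_bigr => i _; rewrite mxE.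
Qed.

Lemma enormZ n (c : R) (x : 'cV[R]_n) : enorm (c *: x) = `|c| * enorm x.
Proof.
rewrite /enorm -sqrtr_sqr -sqrtrM ?sqr_ge0// mulr_sumr.
by congr Num.sqrt; apply: eq_bigr => i _; rewrite mxE exprMn.
Qed.

Lemma enormN n (x : 'cV[R]_n) : enorm (- x) = enorm x.
Proof. by rewrite -scaleN1r enormZ normrN1 mul1r. Qed.

Lemma le_coord_enorm n (x : 'cV[R]_n) i : `|x i ord0| <= enorm x.
Proof.
rewrite -sqrtr_sqr ler_sqrt; last by apply: sumr_ge0 => j _; exact: sqr_ge0.
by rewrite (bigD1 i)//= lerDl sumr_ge0// => j _; exact: sqr_ge0.
Qed.

Lemma enorm_frame p q (A : 'M[R]_(p, q)) (f : 'cV[R]_q) :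
  orthonormal_frames R p q A -> enorm (A *m f) = enorm f.
Proof.
move=> AA; apply/eqP; rewrite -(@eqrXn2 _ 2)// ?enorm_ge0// !sqr_enorm.
by rewrite trmx_mul -mulmxA (mulmxA A^T) AA mul1mx.
Qed.

(** The column [col j A] is a unit vector, its squared norm being the diagonal entry
    [(A^T *m A) j j]. *)
Lemma frame_coord_le1 p q (A : 'M[R]_(p, q)) i j :
  orthonormal_frames R p q A -> `|A i j| <= 1.
Proof.
move=> AA; have -> : A i j = (col j A) i ord0 by rewrite mxE.
apply: le_trans (le_coord_enorm _ _) _.
rewrite -(@expr_le1 _ 2)// ?enorm_ge0// sqr_enorm.
suff -> : ((col j A)^T *m col j A) ord0 ord0 = (A^T *m A) j j.
  by rewrite AA mxE eqxx.
by rewrite !mxE; apply: eq_bigr => k _; rewrite !mxE.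
Qed.

Lemma cvg_enorm n (T : Type) (F : set_system T) (x : T -> 'cV[R]_n)
    (y : 'cV[R]_n) : Filter F ->
  (forall i, x t i ord0 @[t --> F] --> y i ord0) ->
  enorm (x t) @[t --> F] --> enorm y.
Proof.
move=> FF xy; apply: (@continuous_cvg _ _ _ F FF
  (fun t => \sum_(i < n) x t i ord0 ^+ 2) Num.sqrt).
  exact: sqrt_continuous.
apply: cvg_big => [|i _]; first exact: add_continuous.
exact: continuous_cvg (@exprn_continuous _ 2 _) (xy i).
Qed.

Lemma enorm_continuous n : continuous (@enorm R n).
Proof.
move=> x; apply: (@cvg_enorm _ _ (nbhs x) id) => i.
exact: coord_continuous.
Qed.

Lemma cvg_mulmx p q r (T : Type) (F : set_system T) (A : T -> 'M[R]_(p, q))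
    (B : T -> 'M[R]_(q, r)) (A' : 'M[R]_(p, q)) (B' : 'M[R]_(q, r)) i j :
  Filter F -> (forall k, A t i k @[t --> F] --> A' i k) ->
  (forall k, B t k j @[t --> F] --> B' k j) ->
  (A t *m B t) i j @[t --> F] --> (A' *m B') i j.
Proof.
move=> FF AA' BB'; under eq_cvg do rewrite mxE.
rewrite mxE; apply: cvg_big => [|k _]; first exact: add_continuous.
exact: cvgM.
Qed.

(** The entries of [A^T *m A] are polynomials in those of [A], and they stay constant along the
    filter. *)
Lemma frame_limit p q (T : Type) (F : set_system T) (A : T -> 'M[R]_(p, q))
    (B : 'M[R]_(p, q)) : ProperFilter F ->
  (forall t, orthonormal_frames R p q (A t)) ->
  (forall i j, A t i j @[t --> F] --> B i j) -> orthonormal_frames R p q B.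
Proof.
move=> FF AA AB; apply/matrixP => i j.
have cvg_AA : ((A t)^T *m A t) i j @[t --> F] --> (B^T *m B) i j.
  apply: cvg_mulmx => k; last exact: AB.
  by under eq_cvg do rewrite mxE; rewrite mxE; exact: AB.
rewrite -(cvg_lim _ cvg_AA)//; under eq_fun do rewrite AA.
exact: lim_cst.
Qed.

End euclidean_norm.

Lemma continuous_borel_measurable (R : realType) n (g : 'cV[R]_n -> R) :
  continuous g -> measurable_fun [set: borel_cV R n] (g : borel_cV R n -> R).
Proof.
move=> /continuousP cg.
apply: (measurability _ (RGenOpens.measurableE R)).
move=> _ [_ [a [b ->] <-]]; rewrite setTI.
by apply: sub_gen_smallest; apply: cg; exact: interval_open.
Qed.

(** * The integrand and its pointwise limits *)

Section distortion.
Variables (R : realType) (p q : nat) (phi : R -> R).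

Definition distortion (F : {fset 'cV[R]_q}) (A : 'M[R]_(p, q))
    (x : borel_cV R p) : \bar R :=
  (\big[mine/+oo]_(f <- F) (phi (enorm ((x : 'cV[R]_p) - A *m f)))%:E)%E.

Lemma measurable_distortion F A : continuous phi ->
  measurable_fun [set: borel_cV R p] (distortion F A).
Proof.
move=> phi_cont; rewrite /distortion.
elim: (enum_fset F) => [|f s IHs].
  by under eq_fun do rewrite big_nil; exact: measurable_cst.
under eq_fun do rewrite big_cons.
apply: measurable_mine => //; apply/measurable_EFinP.
apply: continuous_borel_measurable => x.
have sub_cont : {for x, continuous (fun y : 'cV[R]_p => y - A *m f)}.
  by apply: continuousB; [exact: cvg_id | exact: cst_continuous].
exact: continuous_comp (continuous_comp sub_cont (@enorm_continuous R p _))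
  (phi_cont _).
Qed.

Lemma distortion_ge0 F A x :
  (forall r, 0 <= phi r) -> (0 <= distortion F A x)%E.
Proof.
by move=> phi_ge0; apply: le_bigmin => [|f _]; rewrite ?leey// lee_fin.
Qed.

Lemma distance_limit (A : nat -> 'M[R]_(p, q)) (B : 'M[R]_(p, q))
    (f : nat -> 'cV[R]_q) (t : R) (g : 'cV[R]_q) (x : 'cV[R]_p) (e : R) :
  {homo phi : r s / r <= s} -> continuous phi ->
  (forall n, orthonormal_frames R p q (A n)) ->
  (forall i j, A n i j @[n --> \oo] --> B i j) ->
  (1 + enorm (f n))^-1 @[n --> \oo] --> t ->
  (forall j, ((1 + enorm (f n))^-1 *: f n) j ord0 @[n --> \oo] --> g j ord0) ->
  0 < e ->
  \forall n \near \oo,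
    phi (enorm (x - B *m (t^-1 *: g))) <= phi (enorm (x - A n *m f n)) + e.
Proof.
move=> phi_nd phi_cont A_frame AB ut ug e_gt0.
set u := fun n => (1 + enorm (f n))^-1 in ut.
have d_gt0 n : 0 < 1 + enorm (f n) by rewrite ltr_pwDl// enorm_ge0.
have u_gt0 n : 0 < u n by rewrite invr_gt0.
have Ag i : (A n *m (u n *: f n)) i ord0 @[n --> \oo] --> (B *m g) i ord0.
  exact: cvg_mulmx.
have [t0|t_neq0] := eqVneq t 0.
  (* u n * |x - A n f n| tends to |B g| = 1 while u n tends to 0. *)
  have gn1 : enorm (u n *: f n) @[n --> \oo] --> (1 : R).
    (* This is [u n * (1 + enorm (f n)) = 1], rearranged. *)
    have uE n : enorm (u n *: f n) = 1 - u n.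
      rewrite enormZ gtr0_norm// /u.
      rewrite -[X in _ = X - _](mulVf (lt0r_neq0 (d_gt0 n))).
      by rewrite mulrDr mulr1 addrAC subrr add0r.
    under eq_cvg do rewrite uE.
    suff : 1 - u n @[n --> \oo] --> 1 - t by rewrite t0 subr0.
    by apply: cvgB => //; exact: cvg_cst.
  have Bg : enorm (B *m g) = 1.
    rewrite enorm_frame; last exact: frame_limit AB.
    by rewrite -(cvg_lim _ gn1)// (cvg_lim _ (cvg_enorm _ ug)).
  have un1 : enorm (u n *: (x - A n *m f n)) @[n --> \oo] --> (1 : R).
    (* The vectors tend to [- (B *m g)]; the vanishing term [t * x i ord0] is put back so that the
       limit matches the sequence term by term. *)
    rewrite -Bg -enormN; apply: cvg_enorm => i.
    have -> : (- (B *m g)) i ord0 = t * x i ord0 - (B *m g) i ord0.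
      by rewrite mxE t0 mul0r sub0r.
    have uE n : (u n *: (x - A n *m f n)) i ord0 =
        u n * x i ord0 - (A n *m (u n *: f n)) i ord0.
      by rewrite scalerBr scalemxAr !mxE.
    under eq_cvg do rewrite uE.
    by apply: cvgB => //; apply: cvgM => //; exact: cvg_cst.
  rewrite t0 invr0 scale0r mulmx0 subr0.
  near=> n.
  apply: ler_wpDr; [exact: ltW | apply: phi_nd; apply: ltW].
  (* The threshold 1/2 separates the limits 1 of [u n * enorm (x - A n *m f n)] and 0 of
     [u n * enorm x]; dividing by [u n] then compares the distances. *)
  have un_half : 2^-1 < enorm (u n *: (x - A n *m f n)).
    by near: n; apply: cvgr_gt un1 _ _; rewrite invf_lt1// ltr1n.
  have xn : u n * enorm x < 2^-1.
    near: n; apply: (@cvgr_lt _ _ _ _ _ (t * enorm x)).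
      by apply: cvgM => //; exact: cvg_cst.
    by rewrite t0 mul0r invr_gt0.
  rewrite -(ltr_pM2l (u_gt0 n)) (lt_trans xn)//.
  by rewrite -{1}(gtr0_norm (u_gt0 n)) -enormZ.
(* For [t != 0] the centres stay bounded, and dividing by [u n] recovers [A n *m f n] from its
   convergent rescaling. *)
have cvg_dist : enorm (x - A n *m f n) @[n --> \oo] -->
    enorm (x - B *m (t^-1 *: g)).
  apply: cvg_enorm => i.
  have fE n : x - A n *m f n = x - (u n)^-1 *: (A n *m (u n *: f n)).
    by rewrite scalemxAr scalerA mulVf ?scale1r// gt_eqF.
  under eq_cvg do rewrite fE !mxE.
  rewrite -scalemxAr !mxE.
  apply: cvgB; first exact: cvg_cst.
  apply: cvgM; first exact: cvgV.
  by have := Ag i; rewrite mxE; under eq_cvg do rewrite mxE.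
have /cvgrPdist_lt /(_ e e_gt0) := cvg_comp _ _ cvg_dist (phi_cont _).
apply: filterS => n /ltr_distlDr /ltW.
Unshelve. all: by end_near. Qed.

End distortion.

(** * Compactness and existence of a minimiser *)

Lemma Xi_nonempty (R : realType) (p q k : nat) : (0 < k)%N -> (q <= p)%N ->
  Xi R p q k !=set0.
Proof.
(* As [q <= p], the matrix [pid_mx q] is the identity block above zero rows. *)
move=> k_gt0 le_qp; exists ([fset 0]%fset, pid_mx q); split => /=.
  by rewrite /center_sets /= cardfs1.
rewrite /orthonormal_frames /= tr_pid_mx mul_pid_mx.
by rewrite minnn (minn_idPr le_qp) pid_mx_1.
Qed.

(** A common index type ['I_k] serves all center sets. Surplus indices yield the default 0, perhaps
    outside [F]; this is harmless, since extra limit centres only lower the minimum. *)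
Lemma center_sets_enum (R : realType) (q k : nat) (F : {fset 'cV[R]_q}) :
  center_sets R q k F ->
  exists f : 'I_k -> 'cV[R]_q, forall y, y \in F -> exists i, f i = y.
Proof.
move=> /andP[_ F_le]; exists (fun i => nth 0 F i) => y yF.
have y_lt : (index y F < k)%N by apply: leq_trans F_le; rewrite index_mem.
by exists (Ordinal y_lt); rewrite /= nth_index.
Qed.

(** Sequential compactness and lower semicontinuity in one statement; it is meant for a minimising
    sequence. *)
Lemma Phi_limit_le (R : realType) (p q k : nat) (phi : R -> R)
    (P : probability (borel_cV R p) R)
    (FA : nat -> {fset 'cV[R]_q} * 'M[R]_(p, q)) :
  (0 < k)%N -> (forall r, 0 <= phi r) -> {homo phi : r s / r <= s} ->
  continuous phi -> (forall n, Xi R p q k (FA n)) ->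
  exists2 GB, Xi R p q k GB & exists2 s : nat -> nat, increasing_seq s &
    (Phi phi GB.1 GB.2 P <=
     limn_einf (fun n => Phi phi (FA (s n)).1 (FA (s n)).2 P))%E.
Proof.
move=> k_gt0 phi_ge0 phi_nd phi_cont FA_Xi.
have A_frame n : orthonormal_frames R p q (FA n).2 by have [] := FA_Xi n.
have /choice[f f_surj] n := center_sets_enum (FA_Xi n).1.
pose t i n := (1 + enorm (f n i))^-1.
have t_ge0 i n : 0 <= t i n by rewrite invr_ge0 addr_ge0// enorm_ge0.
(* All scalar coordinates form one finite family bounded by 1, so a single subsequence serves them
   all. *)
pose u (a : 'I_k + 'I_k * 'I_q + 'I_p * 'I_q) n := match a with
  | inl (inl i) => t i n
  | inl (inr ij) => (t ij.1 n *: f n ij.1) ij.2 ord0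
  | inr ij => (FA n).2 ij.1 ij.2
  end.
have u_le1 a n : `|u a n| <= 1.
  case: a => [[i|[i j]]|[i j]] /=; last exact: frame_coord_le1.
    by rewrite ger0_norm// invf_le1 ?ltr_pwDl ?enorm_ge0// lerDl enorm_ge0.
  apply: le_trans (le_coord_enorm _ _) _; rewrite enormZ ger0_norm//.
  by rewrite ler_pdivrMl ?mulr1 ?ltr_pwDl ?enorm_ge0// lerDr.
have [s s_incr u_cvg] := bounded_family_subseq u_le1.
pose l a := limn (u a \o s).
have u_l a : u a (s n) @[n --> \oo] --> l a by exact: u_cvg.
pose B : 'M[R]_(p, q) := \matrix_(i, j) l (inr (i, j)).
pose g i : 'cV[R]_q :=
  (l (inl (inl i)))^-1 *: (\col_j l (inl (inr (i, j))) : 'cV[R]_q).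
(* Limits may coincide, which [center_sets] allows because it only bounds the cardinality by [k]. *)
pose G := [fset g i | i in 'I_k]%fset.
have AB i j : (FA (s n)).2 i j @[n --> \oo] --> B i j.
  by rewrite mxE; exact: (u_l (inr (i, j))).
exists (G, B); last exists s => //.
  split; last exact: frame_limit AB.
  apply/andP; split => /=.
    rewrite cardfs_gt0; apply/fset0Pn; exists (g (Ordinal k_gt0)).
    exact: in_imfset.
  by apply: leq_trans (leq_imfset_card _ _ _) _; rewrite /= -cardE card_ord.
pose D n := distortion phi (FA (s n)).1 (FA (s n)).2.
have D_ge0 n x : setT x -> (0 <= D n x)%E by move=> _; exact: distortion_ge0.
have D_meas n : measurable_fun setT (D n) by exact: measurable_distortion.
(* Fatou reduces the claim to a pointwise bound by the lower limit of the integrands. *)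
apply: le_trans (fatou P measurableT D_meas D_ge0).
apply: ge0_le_integral => //.
- by move=> x _; exact: distortion_ge0.
- exact: measurable_distortion.
- apply: measurableT_comp => //; apply: measurable_fun_limn_esup => n.
  exact: measurableT_comp.
move=> x _; apply: le_limn_einf => e e_gt0.
have dist i : \forall n \near \oo, phi (enorm ((x : 'cV[R]_p) - B *m g i)) <=
    phi (enorm ((x : 'cV[R]_p) - (FA (s n)).2 *m f (s n) i)) + e.
  apply: distance_limit => //; first exact: (u_l (inl (inl i))).
  by move=> j; rewrite mxE; exact: (u_l (inl (inr (i, j)))).
(* There are finitely many indices [i], so one rank suits them all. *)
apply: filterS (filter_forall _ dist) => n dist_n.
(* With [e] moved to the left, it suffices to bound below each term of the minimum over the [n]-th
   center set. The term of [f (s n) i] is compared with that of [g i], which dominates the minimum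
   over [G]. *)
rewrite -leeBlDr// /D /distortion [leRHS]big_seq.
apply: le_bigmin => [|y yF]; first by rewrite leey.
have [i <-] := f_surj _ _ yF.
rewrite leeBlDr//.
apply: le_trans (_ : (_ <= (phi (enorm ((x : 'cV[R]_p) - B *m g i)))%:E)%E) _.
  by apply: ge_bigmin_seq => //; exact: in_imfset.
by rewrite -EFinD lee_fin.
Qed.

Theorem proposition3 (R : realType) (p q k : nat)
    (p_gt0 : (0 < p)%N) (q_gt0 : (0 < q)%N) (k_gt0 : (0 < k)%N)
    (le_qp : (q <= p)%N)
    (P : probability (borel_cV R p) R)
    (phi : R -> R)
    (phi_ge0 : forall r : R, 0 <= phi r)
    (phi_nondecreasing : {homo phi : r s / r <= s})
    (phi_continuous : continuous phi)
    (phi0 : phi 0 = 0)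
    (phi_doubling : exists2 lambda : R, 0 < lambda &
       forall r : R, 0 < r -> phi (2 * r) <= lambda * phi r)
    (phi_integrable :
       (\int[P]_x (phi (enorm (x : 'cV[R]_p)))%:E < +oo)%E)
    (optimal_value_gt : forall j : nat, (1 <= j < k)%N ->
       (optimal_value q phi k P < optimal_value q phi j P)%E) :
  Theta' q phi k P !=set0.
Proof.
pose values := [set Phi phi FA.1 FA.2 P | FA in Xi R p q k].
have values_neq0 : values != set0.
  apply/set0P; have [FA FA_Xi] := Xi_nonempty R k_gt0 le_qp.
  by exists (Phi phi FA.1 FA.2 P), FA.
have [u u_values u_cvg] := ereal_inf_seq values_neq0.
have /choice[FA FA_u] n : exists FA, Xi R p q k FA /\ Phi phi FA.1 FA.2 P = u n.
  by have [FA ? ?] := u_values n; exists FA.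
have [GB GB_Xi [s s_incr GB_le]] :=
  Phi_limit_le P k_gt0 phi_ge0 phi_nondecreasing phi_continuous
    (fun n => (FA_u n).1).
exists GB; split => //; apply/eqP; rewrite eq_le; apply/andP; split; last first.
  by apply: (@ereal_inf_lbound R values); exists GB.
apply: (le_trans GB_le); under eq_fun do rewrite (FA_u _).2.
(* A subsequence of a minimising sequence is still minimising, so its lower limit is the infimum. *)
have us_cvg := cvg_comp s u (increasing_seq_cvgnoo s_incr) u_cvg.
by rewrite (cvg_limn_einf_sup us_cvg).
Qed.
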